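(* Let $\mathbb{K}$ be an algebraically closed field of characteristic zero, $n\ge 2$, and let $W_n=W_n(\mathbb{K})=\bigoplus_{i\ge -1}W_n^{[i]}$ be the standard grading; put $W_n^{[-2]}=0$. Then for all $i,j\ge -1$ with $(i,j)\ne(0,0)$, $$[W_n^{[i]},W_n^{[j]}]=W_n^{[i+j]}$$ (in particular $[W_n^{[-1]},W_n^{[-1]}]=0$), while for $i=j=0$ one has $[W_n^{[0]},W_n^{[0]}]=M_0\simeq\mathfrak{sl}_n(\mathbb{K})$, where $M_0=\{D\in W_n^{[0]}\mid \operatorname{div}D=0\}$.
   Context: $W_n=W_n(\mathbb{K})$ is the Lie algebra, under the commutator, of all $\mathbb{K}$-derivations of the polynomial ring $A=\mathbb{K}[x_1,\dots,x_n]$; each element is uniquely $D=\sum_{i=1}^n f_i\frac{\partial}{\partial x_i}$ with $f_i\in A$. For $j\ge -1$, $W_n^{[j]}$ is the $\mathbb{K}$-subspace of all $D=\sum_i f_i\frac{\partial}{\partial x_i}$ in which each $f_i$ is either zero or a homogeneous polynomial of degree $j+1$. The divergence of $D=\sum_i f_i\frac{\partial}{\partial x_i}$ is $\operatorname{div}D=\sum_i\frac{\partial f_i}{\partial x_i}$. For subspaces $S,T\subseteq W_n$, $[S,T]$ denotes the $\mathbb{K}$-linear span of all brackets $[s,t]$ with $s\in S$, $t\in T$. *)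

(* Defs.v *)
From HB Require Import structures.
From mathcomp Require Import all_boot all_order all_algebra.
From mathcomp Require Import mpoly.
From mathcomp Require Import boolp classical_sets functions ring.

Set Implicit Arguments.
Unset Strict Implicit.
Unset Printing Implicit Defensive.

Import GRing.Theory.
Local Open Scope ring_scope.
Local Open Scope classical_set_scope.

HB.mixin Record Lmodule_isLieAlgebra (K : fieldType) L of GRing.Lmodule K L := {
  lie : L -> L -> L;
  lie_linearl : forall y, linear (lie^~ y);
  lie_linearr : forall x, linear (lie x);
  liexx : forall x, lie x x = 0;
  lie_jacobi : forall x y z,
    lie x (lie y z) + lie y (lie z x) + lie z (lie x y) = 0
}.

#[short(type="lieAlgType")]
HB.structure Definition LieAlgebra (K : fieldType) :=
  {L of GRing.Lmodule K L & Lmodule_isLieAlgebra K L}.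

Section LieSets.
Variables (K : fieldType) (L : lieAlgType K).

Definition linear_span (S : set L) : set L :=
  [set v | exists m (c : 'I_m -> K) (s : 'I_m -> L),
     (forall k, S (s k)) /\ v = \sum_(k < m) c k *: s k].

Definition lie_set (S T : set L) : set L :=
  linear_span [set lie s t | s in S & t in T].

Definition lie_subalgebra (S : set L) : Prop :=
  [/\ S 0,
      forall a x y, S x -> S y -> S (a *: x + y)
    & forall x y, S x -> S y -> S (lie x y)].

End LieSets.

(* Isomorphism of the Lie subalgebras S and T of two ambient Lie algebras; the
   values of phi outside S are irrelevant. *)
Definition lie_isomorphic (K : fieldType) (L1 L2 : lieAlgType K)
    (S : set L1) (T : set L2) : Prop :=
  [/\ lie_subalgebra S, lie_subalgebra T
    & exists phi : L1 -> L2,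
      [/\ forall a x y, S x -> S y -> phi (a *: x + y) = a *: phi x + phi y,
          forall x y, S x -> S y -> phi (lie x y) = lie (phi x) (phi y)
        & set_bij S T phi]].

Section MatrixLie.
Variables (K : fieldType) (n : nat).
Implicit Types A B C : 'M[K]_n.

Definition mxlie A B : 'M[K]_n := A *m B - B *m A.

Lemma mxlie_linearl B : linear (mxlie^~ B).
Proof.
move=> a x y; rewrite /mxlie mulmxDl mulmxDr -scalemxAl -scalemxAr scalerBr.
by rewrite opprD addrACA.
Qed.

Lemma mxlie_linearr A : linear (mxlie A).
Proof.
move=> a x y; rewrite /mxlie mulmxDl mulmxDr -scalemxAl -scalemxAr scalerBr.
by rewrite opprD addrACA.
Qed.

Lemma mxliexx A : mxlie A A = 0. Proof. exact: subrr. Qed.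

Lemma mxlie_jacobi A B C :
  mxlie A (mxlie B C) + mxlie B (mxlie C A) + mxlie C (mxlie A B) = 0.
Proof.
rewrite /mxlie !mulmxBl !mulmxBr !mulmxA.
move: (A *m B *m C) (A *m C *m B) (B *m C *m A) (B *m A *m C)
  (C *m A *m B) (C *m B *m A) => a b c d e f.
apply/matrixP => i j; rewrite !mxE.
move: (a i j) (b i j) (c i j) (d i j) (e i j) (f i j) => {}a {}b {}c {}d {}e {}f.
by ring.
Qed.

HB.instance Definition _ := Lmodule_isLieAlgebra.Build K 'M[K]_n
  mxlie_linearl mxlie_linearr mxliexx mxlie_jacobi.

Definition sl : set 'M[K]_n := [set A | \tr A = 0].

End MatrixLie.

Record W (n : nat) (K : fieldType) := Derivation {
  der_fun :> {mpoly K[n]} -> {mpoly K[n]};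
  der_linear : linear der_fun;
  der_leibniz : forall f g, der_fun (f * g) = der_fun f * g + f * der_fun g
}.

Section Witt.
Variables (n : nat) (K : fieldType).
Local Notation A := {mpoly K[n]}.
Local Notation W := (W n K).
Implicit Types (D E F : W) (f : 'I_n -> A) (p q : A).

HB.instance Definition _ D :=
  GRing.isLinear.Build K A A *:%R (der_fun D) (der_linear D).

Lemma der_ext D E : (forall p, D p = E p) -> D = E.
Proof.
case: D E => [d dl dm] [e el em] /= /funext de; case: _ / de in el em *.
by rewrite (Prop_irrelevance dl el) (Prop_irrelevance dm em).
Qed.

Lemma der1 D : D 1 = 0.
Proof.
by have /eqP := der_leibniz D 1 1; rewrite !(mulr1, mul1r) -subr_eq0 opprD addrA subrr
  add0r oppr_eq0 => /eqP.
Qed.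

Definition vfield_fun f p : A := \sum_(i < n) f i * p^`M(i).

Lemma vfield_linear f : linear (vfield_fun f).
Proof.
move=> a p q; rewrite /vfield_fun scaler_sumr -big_split; apply: eq_bigr => i _.
by rewrite /= mderivD mderivZ mulrDr scalerAr.
Qed.

Lemma vfield_leibniz f p q :
  vfield_fun f (p * q) = vfield_fun f p * q + p * vfield_fun f q.
Proof.
rewrite /vfield_fun mulr_suml mulr_sumr -big_split; apply: eq_bigr => i _ /=.
rewrite mderivM; ring.
Qed.

Definition vfield f : W := Derivation (vfield_linear f) (vfield_leibniz f).

Lemma mderivXU (i j : 'I_n) : ('X_j : A)^`M(i) = (j == i)%:R.
Proof.
rewrite mderivX mnm1E; case: eqVneq => [->|_]; last by rewrite scale0r.
have -> : (U_(i) - U_(i))%MM = 0%MM by apply/mnmP => k; rewrite mnmBE mnm0E subnn.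
by rewrite mpolyX0 scale1r.
Qed.

Lemma vfieldX f i : vfield f 'X_i = f i.
Proof.
rewrite /= /vfield_fun (bigD1 i) //= mderivXU eqxx mulr1 big1 ?addr0 // => j ji.
by rewrite mderivXU eq_sym (negbTE ji) mulr0.
Qed.

(* The unique decomposition D = \sum_i f_i d/dx_i, with f_i = D(x_i). *)
Lemma derE D : D = vfield (fun i => D 'X_i).
Proof.
apply: der_ext => p; set E := vfield _.
have EX i : D 'X_i = E 'X_i by rewrite vfieldX.
elim/mpolyind: p => [|c m p _ _ IH]; first by rewrite !linear0.
have lin F : F (c *: 'X_[m] + p) = c *: F 'X_[m] + F p by exact: der_linear.
rewrite !lin IH; congr (_ *: _ + _).
rewrite mpolyXE_id; elim/big_ind: _ => [|p1 q1 Hp Hq|i _]; first by rewrite !der1.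
  by rewrite !der_leibniz Hp Hq.
elim: (m i) => [|k IHk]; first by rewrite !expr0 !der1.
by rewrite !exprS !der_leibniz IHk EX.
Qed.

Definition der_coef D : {ffun 'I_n -> A} := [ffun i => D 'X_i].

Lemma der_coefK : cancel der_coef vfield.
Proof.
by move=> D; rewrite [RHS]derE; congr vfield; apply/funext => i; rewrite ffunE.
Qed.

HB.instance Definition _ := Choice.copy W (can_type der_coefK).

Lemma zero_linear : linear (fun _ : A => 0 : A).
Proof. by move=> a p q; rewrite scaler0 addr0. Qed.
Lemma zero_leibniz p q : 0 = 0 * q + p * 0 :> A.
Proof. by rewrite mul0r mulr0 addr0. Qed.
Definition der_zero : W := Derivation zero_linear zero_leibniz.

Lemma add_linear D E : linear (fun p => D p + E p).
Proof. by move=> a p q; rewrite !linearP scalerDr addrACA. Qed.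
Lemma add_leibniz D E p q :
  D (p * q) + E (p * q) = (D p + E p) * q + p * (D q + E q).
Proof. by rewrite !der_leibniz mulrDl mulrDr addrACA. Qed.
Definition der_add D E : W := Derivation (add_linear D E) (add_leibniz D E).

Lemma opp_linear D : linear (fun p => - D p).
Proof. by move=> a p q; rewrite linearP opprD scalerN. Qed.
Lemma opp_leibniz D p q : - D (p * q) = - D p * q + p * - D q.
Proof. by rewrite der_leibniz opprD mulNr mulrN. Qed.
Definition der_opp D : W := Derivation (opp_linear D) (opp_leibniz D).

Lemma scale_linear (a : K) D : linear (fun p => a *: D p).
Proof. by move=> b p q; rewrite linearP scalerDr !scalerA mulrC. Qed.
Lemma scale_leibniz (a : K) D p q :
  a *: D (p * q) = (a *: D p) * q + p * (a *: D q).
Proof. by rewrite der_leibniz scalerDr scalerAl scalerAr. Qed.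
Definition der_scale (a : K) D : W :=
  Derivation (scale_linear a D) (scale_leibniz a D).

Fact der_addA : associative der_add.
Proof. by move=> D E F; apply: der_ext => p /=; rewrite addrA. Qed.
Fact der_addC : commutative der_add.
Proof. by move=> D E; apply: der_ext => p /=; rewrite addrC. Qed.
Fact der_add0 : left_id der_zero der_add.
Proof. by move=> D; apply: der_ext => p /=; rewrite add0r. Qed.
Fact der_addN : left_inverse der_zero der_opp der_add.
Proof. by move=> D; apply: der_ext => p /=; rewrite addNr. Qed.

HB.instance Definition _ :=
  GRing.isZmodule.Build W der_addA der_addC der_add0 der_addN.

Fact der_scaleA a b D : der_scale a (der_scale b D) = der_scale (a * b) D.
Proof. by apply: der_ext => p /=; rewrite scalerA. Qed.
Fact der_scale1 : left_id 1 der_scale.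
Proof. by move=> D; apply: der_ext => p /=; rewrite scale1r. Qed.
Fact der_scaleDr : right_distributive der_scale +%R.
Proof. by move=> a D E; apply: der_ext => p /=; rewrite scalerDr. Qed.
Fact der_scaleDl D : {morph der_scale^~ D : a b / a + b}.
Proof. by move=> a b; apply: der_ext => p /=; rewrite scalerDl. Qed.

HB.instance Definition _ := GRing.Zmodule_isLmodule.Build K W
  der_scaleA der_scale1 der_scaleDr der_scaleDl.

Lemma commutator_linear D E : linear (fun p => D (E p) - E (D p)).
Proof. by move=> a p q; rewrite !der_linear scalerBr opprD addrACA. Qed.
Lemma commutator_leibniz D E p q :
  D (E (p * q)) - E (D (p * q)) =
  (D (E p) - E (D p)) * q + p * (D (E q) - E (D q)).
Proof.
rewrite !der_leibniz !linearD /= !der_leibniz; ring.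
Qed.
Definition der_commutator D E : W :=
  Derivation (commutator_linear D E) (commutator_leibniz D E).

Lemma der_commutator_linearl E : linear (der_commutator^~ E).
Proof.
move=> a D F; apply: der_ext => p /=.
by rewrite der_linear scalerBr opprD addrACA.
Qed.

Lemma der_commutator_linearr D : linear (der_commutator D).
Proof.
move=> a E F; apply: der_ext => p /=.
by rewrite der_linear scalerBr opprD addrACA.
Qed.

Lemma der_commutatorxx D : der_commutator D D = 0.
Proof. by apply: der_ext => p /=; rewrite subrr. Qed.

Lemma der_commutator_jacobi D E F :
  der_commutator D (der_commutator E F) + der_commutator E (der_commutator F D)
  + der_commutator F (der_commutator D E) = 0.
Proof.
apply: der_ext => p /=; rewrite !linearB /=; ring.
Qed.

HB.instance Definition _ := Lmodule_isLieAlgebra.Build K W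
  der_commutator_linearl der_commutator_linearr
  der_commutatorxx der_commutator_jacobi.

(* The library's [d.-homog] holds of 0 for every d. The index ranges over all
   of int: for j < -1 no polynomial is homogeneous of degree j + 1, so the
   component is 0 (see Wdeg_m2). *)
Definition Wdeg (j : int) : set W :=
  [set D | exists f : 'I_n -> A, D = vfield f /\
     forall i, f i = 0 \/ exists2 d : nat, d%:Z = j + 1 & f i \is d.-homog].

Lemma Wdeg_m2 : Wdeg (-2) = [set 0].
Proof.
apply/seteqP; split=> [D [f [-> hf]]|D ->] /=.
  by apply: der_ext => p /=; apply: big1 => i _; case: (hf i) => [->|[]//];
    rewrite mul0r.
exists (fun=> 0); split; last by left.
by apply: der_ext => p /=; rewrite /vfield_fun big1 // => i _; rewrite mul0r.
Qed.

(* The coefficients of D are f_i = D(x_i), by derE. *)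
Definition divergence D : A := \sum_(i < n) (D 'X_i)^`M(i).

Lemma divergence_vfield f :
  divergence (vfield f) = \sum_(i < n) (f i)^`M(i).
Proof. by apply: eq_bigr => i _; rewrite vfieldX. Qed.

Definition M0 : set W := [set D | Wdeg 0 D /\ divergence D = 0].

End Witt.

Arguments Wdeg n K j : clear implicits.
Arguments M0 n K : clear implicits.
Arguments sl K n : clear implicits.

(* Main.v *)
Require Import Defs.
From HB Require Import structures.
From mathcomp Require Import all_boot all_order all_algebra.
From mathcomp Require Import mpoly.
From mathcomp Require Import boolp classical_sets functions.
From mathcomp Require Import zify.

Set Implicit Arguments.
Unset Strict Implicit.
Unset Printing Implicit Defensive.

Import Order.TTheory GRing.Theory Num.Theory.
Local Open Scope ring_scope.
Local Open Scope classical_set_scope.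

(** Write [W_c] for the vector fields whose coefficients are homogeneous of
    degree [c], that is, for the component of index [c - 1]. A derivation
    sends degree [d] to degree [c + d - 1] when it lies in [W_c], so
    [[W_c, W_d]] is contained in [W_(c+d-1)] ([der_homog_lie]). Since [W_e] is
    spanned by the fields [x^m d_k] with [m] of degree [e]
    ([der_sum_monomials]), the converse inclusion only has to be checked on
    these.

    The identity [[x^a d_k, x^b d_k] = (b_k - a_k) x^(a+b-e_k) d_k]
    ([lie_pderXX]) does almost everything: in characteristic 0, it suffices to
    split [m + e_k] as [a + b] with degrees [c], [d] and [a_k <> b_k]. If some
    splitting has [a_k = b_k], one unit of [x_k] can be traded against one
    unit of another variable, which destroys the equality; the trade is
    impossible only if [x^m x_k] is a power of [x_k] and [c = d]
    ([mnm_split_neq]). For that last case, [x_k^(2c-1) d_k], a second variable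
    [x_l] is used: [[x_k^c d_l, x_k^(c-1) x_l d_k]] equals
    [x_k^(2c-1) d_k - c x_k^(2c-2) x_l d_l] ([lie_pderX_neq]), and for [c >= 2]
    the second term is covered by the first identity.

    For [c = d = 1] only the fields [x_l d_k] with [l <> k] and the differences
    [x_k d_k - x_l d_l] are obtained. Reading [W_1] as matrices through the
    coefficients of the [D x_i] turns the bracket into the commutator
    ([lin_mx_lie]) and the divergence into the trace ([divergence_lin]).
    Commutators have trace 0, and the fields just listed span the fields of
    trace 0; this gives both the last equality and the isomorphism with
    [sl_n]. *)

(** * Linear spans of brackets *)

Section Span.
Variables (K : fieldType) (L : lieAlgType K).
Implicit Types (S T : set L) (u v : L).

Lemma linear_span_sub S : S `<=` linear_span S.
Proof.
move=> v Sv; exists 1%N, (fun=> 1), (fun=> v).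
by split=> //; rewrite big_ord1 scale1r.
Qed.

Lemma linear_spanP S a u v :
  linear_span S u -> linear_span S v -> linear_span S (a *: u + v).
Proof.
move=> [m1 [c1 [s1 [Ss1 ->]]]] [m2 [c2 [s2 [Ss2 ->]]]].
pose glue (X : Type) (f : 'I_m1 -> X) (g : 'I_m2 -> X) (k : 'I_(m1 + m2)) : X :=
  match fintype.split k with inl i => f i | inr i => g i end.
exists (m1 + m2)%N, (glue K (fun i => a * c1 i) c2), (glue L s1 s2).
split=> [k|]; first by rewrite /glue; case: (fintype.split k).
rewrite big_split_ord scaler_sumr; congr (_ + _); apply: eq_bigr => i _.
  by rewrite /glue (unsplitK (inl i)) scalerA.
by rewrite /glue (unsplitK (inr i)).
Qed.

Lemma linear_span0 S : linear_span S 0.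
Proof.
by exists 0%N, (fun=> 0), (fun=> 0); split=> [[]//|]; rewrite big_ord0.
Qed.

Lemma linear_spanZ S a u : linear_span S u -> linear_span S (a *: u).
Proof.
by move=> Su; rewrite -[_ *: _]addr0; apply: linear_spanP => //; exact: linear_span0.
Qed.

Lemma linear_span_sum S (I : eqType) (r : seq I) (P : pred I) (F : I -> L) :
  (forall i, i \in r -> P i -> linear_span S (F i)) ->
  linear_span S (\sum_(i <- r | P i) F i).
Proof.
move=> SF; rewrite big_seq_cond.
elim/big_rec: _ => [|i v /andP[ri Pi] Sv]; first exact: linear_span0.
by rewrite -[F i]scale1r; apply: linear_spanP => //; exact: SF.
Qed.

Lemma linear_span_min S T :
  S `<=` T -> T 0 -> (forall a u v, T u -> T v -> T (a *: u + v)) ->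
  linear_span S `<=` T.
Proof.
move=> ST T0 Tlin _ [m [c [s [Ss ->]]]].
by elim/big_rec: _ => // k v _ Tv; apply: Tlin => //; exact/ST/Ss.
Qed.

Lemma lie_set_lie S T u v : S u -> T v -> lie_set S T (lie u v).
Proof. by move=> Su Tv; apply: linear_span_sub; exists u => //; exists v. Qed.

End Span.

Lemma pchar0_natr_inj (K : fieldType) :
  [pchar K] =i pred0 -> injective (fun k : nat => k%:R : K).
Proof.
move=> /pcharf0P K0 m k /= mk; wlog le_mk : m k mk / (m <= k)%N => [hw|].
  by case: (leqP m k) => [|/ltnW] le; [|symmetry]; apply: hw.
have: (k - m)%:R == 0 :> K by rewrite natrB // mk subrr.
by rewrite K0; lia.
Qed.

(** * Splitting a monomial unevenly in one variable *)

Section Multinomials.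
Variable n : nat.
Implicit Types (m a b : 'X_{1..n}) (k l : 'I_n).

Lemma mdeg_submU m k : (0 < m k)%N -> mdeg (m - U_(k))%MM = (mdeg m).-1.
Proof.
move=> mk; have /submK {2}<- : (U_(k) <= m)%MM by rewrite lep1mP -lt0n.
by rewrite mdegD mdeg1 addn1.
Qed.

Lemma exists_mnm_le m d :
  (d <= mdeg m)%N -> exists2 a : 'X_{1..n}, (a <= m)%MM & mdeg a = d.
Proof.
elim: d => [|d IHd] lt_dm.
  by exists 0%MM; [apply/mnm_lepP => i; rewrite mnm0E|exact: mdeg0].
have [a le_am ad] := IHd (ltnW lt_dm).
have [l al] : exists l, (a l < m l)%N.
  apply/existsP; apply: contraTT lt_dm; rewrite negb_exists -leqNgt => /forallP h.
  rewrite -ad !mdegE; by apply: leq_sum => i _; rewrite leqNgt.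
exists (a + U_(l))%MM; last by rewrite mdegD mdeg1 ad addn1.
apply/mnm_lepP => i; rewrite mnmDE mnm1E; have /mnm_lepP/(_ i) := le_am.
by case: eqVneq => [<-|_]; rewrite ?addn1 ?addn0.
Qed.

(** Start from any factor [a] of degree [c], with cofactor [b]. If
    [a k = b k], exchange one [x_k] of one factor with one [x_l], [l != k], of
    the other. When no such [x_l] exists, both factors are the same power of
    [x_k], which is the excluded case. *)
Lemma mnm_split_neq m k c d :
  (c + d)%N = mdeg m -> (0 < m k)%N -> ~ (c = d /\ m = (U_(k) *+ (2 * c))%MM) ->
  exists a b, [/\ (a + b)%MM = m, mdeg a = c, mdeg b = d & a k <> b k].
Proof.
move=> cd mk good.
have [a le_am ac] : exists2 a : 'X_{1..n}, (a <= m)%MM & mdeg a = c.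
  by apply: exists_mnm_le; rewrite -cd leq_addr.
pose b := (m - a)%MM; have ab : (a + b)%MM = m by rewrite addmC submK.
have bd : mdeg b = d by move: cd; rewrite -ab mdegD; lia.
case: (eqVneq (a k) (b k)) => [abk|/eqP]; last by exists a, b.
have ak : (0 < a k)%N by move: mk; rewrite -ab mnmDE; lia.
have bk : (0 < b k)%N by rewrite -abk.
(* The exchange makes the two exponents of x_k differ by two. *)
have shift (u v : 'X_{1..n}) l : (0 < u k)%N -> u k = v k -> (0 < v l)%N -> l != k ->
    [/\ (u - U_(k) + U_(l) + (v - U_(l) + U_(k)))%MM = (u + v)%MM,
       mdeg (u - U_(k) + U_(l))%MM = mdeg u,
       mdeg (v - U_(l) + U_(k))%MM = mdeg v &
       (u - U_(k) + U_(l))%MM k <> (v - U_(l) + U_(k))%MM k].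
  move=> uk uvk vl lk; have pos (w : 'X_{1..n}) j : (0 < w j)%N -> (0 < mdeg w)%N.
    by move=> wj; rewrite mdegE (bigD1 j) //=; lia.
  split.
  - apply/mnmP => i; rewrite !(mnmDE, mnmBE, mnm1E).
    case: (eqVneq k i) => [<-|ki]; first by rewrite (negbTE lk); lia.
    by case: (eqVneq l i) => [<-|li]; lia.
  - by rewrite mdegD mdeg1 mdeg_submU //; have := pos _ _ uk; lia.
  - by rewrite mdegD mdeg1 mdeg_submU //; have := pos _ _ vl; lia.
  - by rewrite !(mnmDE, mnmBE, mnm1E) eqxx (negbTE lk); lia.
have [/existsP[l /andP[lk bl]]|] := boolP [exists l, (l != k) && (0 < b l)%N].
  have [? ? ? ?] := shift a b l ak abk bl lk.
  by do 2 eexists; split; [rewrite -ab; eassumption|rewrite -ac; eassumption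
    |rewrite -bd; eassumption|].
rewrite negb_exists => /forallP b0.
have [/existsP[l /andP[lk al]]|] := boolP [exists l, (l != k) && (0 < a l)%N].
  have [e1 ? ? ?] := shift b a l bk (esym abk) al lk.
  exists (a - U_(l) + U_(k))%MM, (b - U_(k) + U_(l))%MM.
  by split; rewrite -?ac -?bd // -?ab 1?addmC ?e1 1?addmC //; exact: nesym.
rewrite negb_exists => /forallP a0; case: good.
have ck : c = a k.
  rewrite -ac mdegE (bigD1 k) //= big1 ?addn0 // => l lk.
  by have := a0 l; rewrite lk; lia.
have dk : d = b k.
  rewrite -bd mdegE (bigD1 k) //= big1 ?addn0 // => l lk.
  by have := b0 l; rewrite lk; lia.
split; first by lia.
apply/mnmP => l; rewrite -ab mnmDE mulmnE mnm1E eq_sym.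
case: eqVneq => [->|lk]; first by lia.
by have := b0 l; have := a0 l; rewrite lk; lia.
Qed.

End Multinomials.

(** * Homogeneous derivations and partial derivations *)

Section Derivations.
Variables (n : nat) (K : fieldType).
Local Notation A := {mpoly K[n]}.
Local Notation W := (W n K).
Implicit Types (D E : W) (p q : A) (k l i : 'I_n).

Lemma der_extX D E : (forall i, D 'X_i = E 'X_i) -> D = E.
Proof. by move=> DE; rewrite [D]derE [E]derE; congr vfield; apply/funext. Qed.

Lemma der_sumE (I : Type) (r : seq I) (P : pred I) (F : I -> W) p :
  (\sum_(i <- r | P i) F i) p = \sum_(i <- r | P i) F i p.
Proof. exact: (big_morph (fun D : W => D p)). Qed.

Lemma dhomog0_mderiv p i : p \is 0.-homog -> p^`M(i) = 0.
Proof.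
move=> /dhomogP hp; rewrite [p]mpolyE linear_sum big_seq big1 //= => m /hp /eqP.
by rewrite mdeg_eq0 => /eqP ->; rewrite mderivZ mderivX mnm0E scale0r scaler0.
Qed.

Lemma dhomog_mderiv d p i : p \is d.+1.-homog -> p^`M(i) \is d.-homog.
Proof.
move=> /dhomogP hp; rewrite [p]mpolyE linear_sum big_seq.
apply: rpred_sum => m /hp md; rewrite /= mderivZ mderivX.
apply: dhomogZ; case: (posnP (m i)) => [->|mi]; first by rewrite scale0r dhomog0.
by apply: dhomogZ; rewrite dhomogX /= mdeg_submU // md.
Qed.

(** The degree is that of the coefficients, one more than the index of the
    component in the grading, which keeps it a natural number. *)
Definition der_homog (d : nat) D := forall i, D 'X_i \is d.-homog.

Lemma der_const D p : p \is 0.-homog -> D p = 0.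
Proof.
move=> hp; rewrite [D]derE /= /vfield_fun big1 // => i _.
by rewrite dhomog0_mderiv ?mulr0.
Qed.

Lemma der_homogE c d D p :
  der_homog c D -> p \is d.+1.-homog -> D p \is (c + d)%N.-homog.
Proof.
move=> hD hp; rewrite [D]derE /= /vfield_fun; apply: rpred_sum => i _.
by apply: dhomogM => //; exact: dhomog_mderiv.
Qed.

(** The predecessor of [0] is [0], but [c = d = 0] is no exception: two
    constant fields commute, and [0] is homogeneous of every degree. *)
Lemma der_homog_lie c d D E :
  der_homog c D -> der_homog d E -> der_homog (c + d).-1 (lie D E).
Proof.
have half c' d' D' E' i : der_homog c' D' -> der_homog d' E' ->
    D' (E' 'X_i) \is (c' + d').-1.-homog.
  case: d' => [|d'] hD hE; first by rewrite der_const ?dhomog0.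
  by rewrite addnS; exact: der_homogE.
move=> hD hE i; rewrite /lie /=; apply: rpredB; first exact: half.
by rewrite addnC; exact: half.
Qed.

Lemma WdegP (d : nat) D : Wdeg n K (d%:Z - 1) D <-> der_homog d D.
Proof.
split=> [[f [-> hf]] i|hD]; last first.
  exists (fun i => D 'X_i); split; first exact: derE.
  by move=> i; right; exists d => //; rewrite subrK.
rewrite vfieldX; case: (hf i) => [->|[e]]; first exact: dhomog0.
by rewrite subrK => -[->].
Qed.

Lemma der_homog0 d : der_homog d 0.
Proof. by move=> i; exact: dhomog0. Qed.

Lemma der_homogP d a D E :
  der_homog d D -> der_homog d E -> der_homog d (a *: D + E).
Proof. by move=> hD hE i; apply: rpredD => //; apply: rpredZ. Qed.

Definition pder p k : W := vfield (fun i => p *+ (i == k)).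

Lemma pderX p k i : pder p k 'X_i = p *+ (i == k).
Proof. exact: vfieldX. Qed.

Lemma pderE p k q : pder p k q = p * q^`M(k).
Proof.
rewrite /= /vfield_fun (bigD1 k) //= eqxx big1 ?addr0 // => i /negbTE ->.
by rewrite mul0r.
Qed.

Lemma der_homog_pder d p k : p \is d.-homog -> der_homog d (pder p k).
Proof. by move=> hp i; rewrite pderX; apply: rpredMn. Qed.

Lemma der_sum_coord (F : 'I_n -> W) i :
  (forall k, k != i -> F k 'X_i = 0) -> (\sum_k F k) 'X_i = F i 'X_i.
Proof. by move=> F0; rewrite der_sumE (bigD1 i) //= big1 ?addr0. Qed.

Lemma der_sum_monomials D :
  D = \sum_k \sum_(m <- msupp (D 'X_k)) (D 'X_k)@_m *: pder 'X_[m] k.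
Proof.
apply: der_extX => i; rewrite der_sum_coord => [|k ki]; rewrite der_sumE.
  rewrite [LHS]mpolyE; apply: eq_bigr => m _.
  by rewrite -[RHS]/(_ *: pder _ _ _) pderX eqxx.
rewrite big1 // => m _.
by rewrite -[LHS]/(_ *: pder _ _ _) pderX eq_sym (negbTE ki) scaler0.
Qed.

Lemma pderZ c p k : pder (c *: p) k = c *: pder p k.
Proof.
apply: der_extX => i; rewrite -[RHS]/(c *: pder p k 'X_i) !pderX.
by rewrite scalerMnr.
Qed.

Lemma lie_pder p q k l :
  lie (pder p k) (pder q l) = pder (p * q^`M(k)) l - pder (q * p^`M(l)) k.
Proof.
apply: der_extX => i.
rewrite -[LHS]/(pder p k (pder q l 'X_i) - pder q l (pder p k 'X_i)).
rewrite -[RHS]/(pder _ l 'X_i - pder _ k 'X_i) !pderX.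
by rewrite !raddfMn; congr (_ *+ _ + (- _) *+ _); exact: pderE.
Qed.

(** If [b k = 0], the truncated exponent on the right is multiplied by 0. *)
Lemma mpolyX_mulmderiv (a b : 'X_{1..n}) k :
  'X_[a] * 'X_[b]^`M(k) = (b k)%:R *: 'X_[(a + b - U_(k))%MM] :> A.
Proof.
rewrite mderivX -scalerAr; case: (posnP (b k)) => [->|bk]; first by rewrite !scale0r.
by rewrite -mpolyXD addmBA // lep1mP -lt0n.
Qed.

Lemma lie_pderXX (a b : 'X_{1..n}) k :
  lie (pder 'X_[a] k) (pder 'X_[b] k) =
  ((b k)%:R - (a k)%:R) *: pder 'X_[(a + b - U_(k))%MM] k.
Proof.
by rewrite lie_pder !mpolyX_mulmderiv !pderZ scalerBl (addmC b a).
Qed.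

(** The source of the fields [x_k^(2c-1) d_k], which [lie_pderXX] cannot
    produce from two factors of equal degree. *)
Lemma lie_pderX_neq c k l : k != l ->
  lie (pder 'X_[U_(k) *+ c.+1] l) (pder 'X_[U_(k) *+ c + U_(l)] k) =
  pder 'X_[U_(k) *+ (c + c).+1] k
  - c.+1%:R *: pder 'X_[U_(k) *+ (c + c) + U_(l)] l.
Proof.
move=> kl; rewrite lie_pder !mpolyX_mulmderiv !pderZ.
rewrite !(mnmDE, mulmnE, mnm1E) !eqxx (negbTE kl) mul0n mul1n scale1r.
by congr (pder 'X_[_] _ - _ *: pder 'X_[_] _); apply/mnmP => i;
  rewrite !(mnmDE, mnmBE, mulmnE, mnm1E); lia.
Qed.

(** * Linear vector fields as matrices *)

Lemma dhomog1_mpolyX k : ('X_k : A) \is 1.-homog.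
Proof. by rewrite dhomogX /= mdeg1. Qed.

(** Column [i] holds the coefficients of [D x_i], i.e. this is the matrix of
    [D] acting on linear forms. With the transpose, the bracket would become
    the opposite of the commutator. *)
Definition lin_mx D : 'M[K]_n := \matrix_(l, i) (D 'X_i)@_U_(l).

Definition lin_der (B : 'M[K]_n) : W := vfield (fun i => \sum_l B l i *: 'X_l).

Lemma lin_derK : cancel lin_der lin_mx.
Proof.
move=> B; apply/matrixP => l i; rewrite mxE vfieldX linear_sum (bigD1 l) //=.
rewrite mcoeffZ mcoeffXU eqxx mulr1 big1 ?addr0 // => j jl.
by rewrite mcoeffZ mcoeffXU (negbTE jl) mulr0.
Qed.

Lemma lin_der_homog B : der_homog 1 (lin_der B).
Proof.
move=> i; rewrite vfieldX; apply: rpred_sum => l _.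
by apply: dhomogZ; exact: dhomog1_mpolyX.
Qed.

Lemma lin_mxK D : der_homog 1 D -> lin_der (lin_mx D) = D.
Proof.
move=> hD; apply: der_extX => i; apply/mpolyP => m.
have [/mdeg1P[j /eqP ->]|m1] := boolP (mdeg m == 1%N).
  by have /matrixP/(_ j i) := lin_derK (lin_mx D); rewrite !mxE.
rewrite (dhomog_nemf_coeff (hD i)) //.
by rewrite (dhomog_nemf_coeff (lin_der_homog _ i)).
Qed.

Lemma lin_mxP a D E : lin_mx (a *: D + E) = a *: lin_mx D + lin_mx E.
Proof.
by apply/matrixP => l i; rewrite !mxE -mcoeffZ -mcoeffD.
Qed.

Lemma lin_mx_comp D E i l : der_homog 1 D -> der_homog 1 E ->
  (D (E 'X_i))@_U_(l) = (lin_mx D *m lin_mx E) l i.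
Proof.
move=> hD hE; rewrite mxE -{1}(lin_mxK hE) vfieldX linear_sum linear_sum /=.
by apply: eq_bigr => j _; rewrite linearZ /= mcoeffZ mulrC [lin_mx D _ _]mxE.
Qed.

Lemma lin_mx_lie D E : der_homog 1 D -> der_homog 1 E ->
  lin_mx (lie D E) = lie (lin_mx D) (lin_mx E).
Proof.
move=> hD hE; apply/matrixP => l i.
rewrite [LHS]mxE -[lie D E _]/(D (E 'X_i) - E (D 'X_i)) mcoeffB !lin_mx_comp //.
by rewrite /lie /= /mxlie !mxE.
Qed.

Lemma divergence_lin D : der_homog 1 D -> divergence D = (\tr (lin_mx D))%:MP.
Proof.
move=> hD; rewrite /divergence /mxtrace rmorph_sum; apply: eq_bigr => i _ /=.
rewrite -{1}(lin_mxK hD) vfieldX linear_sum (bigD1 i) //= big1 => [|l li].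
  by rewrite mderivZ mderivXU eqxx addr0 -mul_mpolyC mulr1.
by rewrite mderivZ mderivXU (negbTE li) scaler0.
Qed.

Lemma M0P D : M0 n K D <-> der_homog 1 D /\ \tr (lin_mx D) = 0.
Proof.
have W0 := WdegP 1 D; rewrite subrr in W0.
split=> [[/W0 hD]|[hD tr0]].
  by rewrite divergence_lin // => /eqP; rewrite mpolyC_eq0 => /eqP.
by split; [exact/W0|rewrite divergence_lin // tr0 mpolyC0].
Qed.
End Derivations.

(** * Brackets of graded components *)

Section Brackets.
Variables (n : nat) (K : fieldType).
Hypothesis K0 : [pchar K] =i pred0.
Local Notation H d := (Wdeg n K (d%:Z - 1)).
Implicit Types (k l : 'I_n) (m : 'X_{1..n}) (c d : nat).

Lemma der_homog_pderX m k : der_homog (mdeg m) (pder ('X_[m] : {mpoly K[n]}) k).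
Proof. by apply: der_homog_pder; rewrite dhomogX. Qed.

(** Split [m + e_k] by [mnm_split_neq] and divide [lie_pderXX] by the nonzero
    scalar [b_k - a_k]. The excluded case is that of [mnm_split_neq]. *)
Lemma pderX_in_lie_set c d m k :
  (c + d)%N = (mdeg m).+1 -> ~ (c = d /\ m = (U_(k) *+ (2 * c).-1)%MM) ->
  lie_set (H c) (H d) (pder 'X_[m] k).
Proof.
move=> cd good.
have [||[cEd mUE]|a [b [ab ac bd abk]]] := @mnm_split_neq n (m + U_(k))%MM k c d.
- by rewrite cd mdegD mdeg1 addn1.
- by rewrite mnmDE mnm1E eqxx addn1.
- apply: good; split=> //; apply/mnmP => i; have /mnmP/(_ i) := mUE.
  by rewrite !(mnmDE, mulmnE, mnm1E); case: eqVneq => _; lia.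
pose r : K := (b k)%:R - (a k)%:R.
have r0 : r != 0.
  by rewrite subr_eq0; apply/eqP => /(pchar0_natr_inj K0) /esym.
have := lie_pderXX K a b k; rewrite ab addmK -/r => brE.
rewrite -[pder _ _]scale1r -(mulVf r0) -scalerA -brE.
apply/linear_spanZ/lie_set_lie; apply/WdegP.
  by rewrite -ac; exact: der_homog_pderX.
by rewrite -bd; exact: der_homog_pderX.
Qed.

Lemma pderX_pure_in_lie_set c k l : k != l ->
  lie_set (H c.+1) (H c.+1)
    (pder 'X_[U_(k) *+ (c + c).+1] k
     - c.+1%:R *: pder 'X_[U_(k) *+ (c + c) + U_(l)] l).
Proof.
move=> kl; rewrite -lie_pderX_neq //; apply: lie_set_lie; apply/WdegP;
  apply: der_homog_pder; rewrite dhomogX /=.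
  by rewrite mdegMn mdeg1 mul1n.
by rewrite mdegD mdegMn !mdeg1 mul1n addn1.
Qed.

Lemma exists_ord_neq k : (2 <= n)%N -> exists l, k != l.
Proof.
move=> n2; apply/existsP; apply: contraTT n2; rewrite negb_exists => /forallP kE.
rewrite -ltnNge ltnS -[n]card_ord; apply/card_le1_eqP => i j _ _.
by rewrite -(eqP (negbNE (kE i))) -(eqP (negbNE (kE j))).
Qed.

(** The case left over by [pderX_in_lie_set] is [x_k^(2c-1) d_k] with
    [c = d >= 2]; it follows from [pderX_pure_in_lie_set], because the other
    term there, [x_k^(2c-2) x_l d_l], involves both [x_k] and [x_l] and is
    therefore covered by [pderX_in_lie_set]. *)
Lemma pderX_in_lie_set_ge2 c d m k : (2 <= n)%N ->
  (c + d)%N = (mdeg m).+1 -> (c, d) <> (1%N, 1%N) ->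
  lie_set (H c) (H d) (pder 'X_[m] k).
Proof.
move=> n2 cd cd1.
have [[cEd mE]|] := pselect (c = d /\ m = (U_(k) *+ (2 * c).-1)%MM); last first.
  exact: pderX_in_lie_set.
have [l kl] := exists_ord_neq k n2.
subst d; case: c cd cd1 mE => [|c] cd cd1 ->; first by [].
have -> : (2 * c.+1).-1 = (c + c).+1 by lia.
rewrite -[pder _ _](subrK (c.+1%:R *: pder 'X_[U_(k) *+ (c + c) + U_(l)] l)).
rewrite [X in lie_set _ _ X]addrC.
apply: linear_spanP; last exact: pderX_pure_in_lie_set.
apply: pderX_in_lie_set => [|[_ /mnmP/(_ k)]].
  by rewrite mdegD mdegMn !mdeg1; lia.
rewrite !(mnmDE, mulmnE, mnm1E) eqxx eq_sym (negbTE kl) mul0n mul1n => c0.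
by apply: cd1; have -> : c = 0%N by lia.
Qed.

Lemma lie_set_homog c d D :
  lie_set (H c) (H d) D -> der_homog (c + d).-1 D.
Proof.
apply: linear_span_min => [_ [E /WdegP hE [F /WdegP hF <-]]||a E F].
- exact: der_homog_lie.
- exact: der_homog0.
- exact: der_homogP.
Qed.

Lemma lie_set_const D : lie_set (H 0) (H 0) D -> D = 0.
Proof.
apply: (@linear_span_min _ _ _ [set 0]) => [_ [E /WdegP hE [F /WdegP hF <-]]||a E F].
- apply: der_extX => i; rewrite -[LHS]/(E (F 'X_i) - F (E 'X_i)).
  by rewrite (der_const E (hF i)) (der_const F (hE i)) subrr.
- by [].
- by move=> -> ->; rewrite scaler0 addr0.
Qed.

Lemma lie_set_Wdeg c d : (2 <= n)%N -> (c, d) <> (1%N, 1%N) ->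
  lie_set (H c) (H d) = Wdeg n K ((c%:Z - 1) + (d%:Z - 1)).
Proof.
move=> n2 cd1; case: (posnP (c + d)) => [|cd].
  case: c d {cd1} => [|//] [|//] _.
  have -> : (0%:Z - 1 + (0%:Z - 1) : int) = -2 by [].
  by rewrite Wdeg_m2; apply/seteqP; split=> [D /lie_set_const|_ ->] //;
    exact: linear_span0.
have -> : (c%:Z - 1 + (d%:Z - 1) = (c + d).-1%:Z - 1 :> int)%R by lia.
apply/seteqP; split=> [D /lie_set_homog /WdegP //|D /WdegP hD].
rewrite [D]der_sum_monomials; apply: linear_span_sum => k _ _.
apply: linear_span_sum => m mD _; apply: linear_spanZ.
apply: pderX_in_lie_set_ge2 => //.
by have /dhomogP/(_ m mD) /= -> := hD k; rewrite prednK.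
Qed.

Lemma lin_der_sum (B : 'M[K]_n) :
  lin_der B = \sum_i \sum_l B l i *: pder 'X_l i.
Proof.
apply: der_extX => j; rewrite vfieldX der_sum_coord => [|i ij]; rewrite der_sumE.
  apply: eq_bigr => l _.
  by rewrite -[RHS]/(_ *: pder _ _ _) pderX eqxx.
rewrite big1 // => l _.
by rewrite -[LHS]/(_ *: pder _ _ _) pderX eq_sym (negbTE ij) scaler0.
Qed.

(** A commutator has trace 0. Conversely, subtracting [tr B] times
    [x_k d_k], for one fixed [k], from the field of a matrix [B] writes it as a
    combination of the [x_l d_i] with [l != i] and of the
    [x_i d_i - x_k d_k], all of which are brackets. *)
Lemma lie_set_Wdeg0 : (2 <= n)%N ->
  lie_set (Wdeg n K 0) (Wdeg n K 0) = M0 n K.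
Proof.
have -> : (0 : int) = 1%:Z - 1 by [].
move=> n2; apply/seteqP; split=> D.
  move: D; apply: linear_span_min => [_ [E /WdegP hE [F /WdegP hF <-]]||a E F].
  - apply/M0P; split; first exact: (der_homog_lie hE hF).
    by rewrite lin_mx_lie // /lie /= /mxlie linearB /= mxtrace_mulC subrr.
  - apply/M0P; split; first exact: der_homog0.
    by rewrite /mxtrace big1 // => i _; rewrite mxE mcoeff0.
  - move=> /M0P[hE trE] /M0P[hF trF]; apply/M0P; split; first exact: der_homogP.
    by rewrite lin_mxP linearP /= trE trF mulr0 addr0.
move=> /M0P[hD trD]; pose k := Ordinal (ltnW n2).
rewrite -(lin_mxK hD); set B := lin_mx D in trD *.
have -> : lin_der B =
    \sum_i \sum_l B l i *: (pder 'X_l i - (l == i)%:R *: pder 'X_k k).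
  transitivity (lin_der B - \sum_i B i i *: pder 'X_k k).
    by rewrite -scaler_suml -/(\tr B) trD scale0r subr0.
  rewrite lin_der_sum -sumrB; apply: eq_bigr => i _.
  under [RHS]eq_bigr do rewrite scalerBr scalerA.
  rewrite sumrB; congr (_ - _); rewrite (bigD1 i) //= eqxx mulr1 big1 ?addr0 //.
  by move=> l /negbTE->; rewrite mulr0 scale0r.
apply: linear_span_sum => i _ _; apply: linear_span_sum => l _ _.
apply: linear_spanZ; case: (eqVneq l i) => [->|li]; last first.
  rewrite scale0r subr0; apply: pderX_in_lie_set; first by rewrite mdeg1.
  case=> _ /mnmP/(_ l); rewrite mulmnE !mnm1E eqxx eq_sym (negbTE li).
  by rewrite mul0n.
case: (eqVneq i k) => [->|ik].
  by rewrite scale1r [X in linear_span _ X]subrr; exact: linear_span0.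
have := @pderX_pure_in_lie_set 0 i k ik; congr (lie_set _ _ _).
by congr (pder 'X_[_] _ - _ *: pder 'X_[_] _); apply/mnmP => j;
  rewrite !(mnmDE, mulmnE, mnm1E); lia.
Qed.

Lemma M0_isomorphic_sl : (2 <= n)%N -> lie_isomorphic (M0 n K) (sl K n).
Proof.
move=> n2; split.
- rewrite -lie_set_Wdeg0 //; split=> [|a D E|D E].
  + exact: linear_span0.
  + exact: linear_spanP.
  + by rewrite {1 2}lie_set_Wdeg0 // => -[D0 _] [E0 _]; exact: lie_set_lie.
- split=> [|a B C|B C _ _]; rewrite /sl /=.
  + exact: mxtrace0.
  + by move=> trB trC; rewrite linearP /= trB trC mulr0 addr0.
  + by rewrite /lie /= /mxlie linearB /= mxtrace_mulC subrr.
exists (@lin_mx n K); split=> [a D E _ _|D E /M0P[hD _] /M0P[hE _]|].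
- exact: lin_mxP.
- exact: lin_mx_lie.
split=> [D /M0P[_ trD] //|D E|B trB].
  by move=> /set_mem/M0P[hD _] /set_mem/M0P[hE _] DE; rewrite -(lin_mxK hD) DE lin_mxK.
exists (lin_der B); last exact: lin_derK.
by apply/M0P; split; [exact: lin_der_homog|rewrite lin_derK].
Qed.

End Brackets.

Theorem corollary1 (K : closedFieldType) (charK0 : [pchar K] =i pred0)
    (n : nat) (n_ge2 : (2 <= n)%N) :
  [/\ forall i j : int, -1 <= i -> -1 <= j -> (i, j) <> (0, 0) ->
        lie_set (Wdeg n K i) (Wdeg n K j) = Wdeg n K (i + j),
      lie_set (Wdeg n K (-1)) (Wdeg n K (-1)) = [set 0],
      lie_set (Wdeg n K 0) (Wdeg n K 0) = M0 n K
    & lie_isomorphic (M0 n K) (sl K n)].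
Proof.
have eqW (i j : int) : -1 <= i -> -1 <= j -> (i, j) <> (0, 0) ->
    lie_set (Wdeg n K i) (Wdeg n K j) = Wdeg n K (i + j).
  move=> ige jge ij0.
  have shift (z : int) : -1 <= z -> exists c : nat, z = c%:Z - 1.
    by move=> zge; exists (absz (z + 1)); lia.
  have [c iE] := shift i ige; have [d jE] := shift j jge; rewrite iE jE.
  apply: lie_set_Wdeg => // -[c1 d1]; apply: ij0.
  by rewrite iE jE c1 d1.
split=> //.
- by rewrite eqW // -Wdeg_m2.
- exact: lie_set_Wdeg0.
- exact: M0_isomorphic_sl.
Qed.
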